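(* Let $G$ be a countable infinite discrete group, $X$ a compact metrizable abelian group with normalized Haar measure $\nu$, and $\sigma: G\curvearrowright (X,\nu)$ an algebraic action. Suppose $\sigma$ is weakly mixing as a p.m.p. action. Then the natural map $\Psi_1: H^1(G,\mathbb{T})\to H^1(G\curvearrowright X;\mathbb{T})$ is injective, and the map $$\Phi_1: H^1(G,\widehat{X})\to \frac{H^1(G\curvearrowright X;\mathbb{T})}{\Psi_1(H^1(G,\mathbb{T}))},\qquad \Phi_1([c])=[\tilde c]+\Psi_1(H^1(G,\mathbb{T})),$$ where $\tilde c(g,x)=c(g)(x)$, is a well-defined injective group homomorphism.
   Context: An algebraic action of $G$ is a homomorphism $G\to \mathrm{Aut}(X)$ into the group of continuous automorphisms of a compact metrizable abelian group $X$; it preserves Haar measure. $\widehat X$ is the Pontryagin dual (continuous homomorphisms $X\to\mathbb{T}$, $\mathbb{T}$ the unit circle), a left $\mathbb{Z}G$-module via $(g\chi)(x)=\chi(g^{-1}x)$. A p.m.p. action is weakly mixing if the diagonal action on $(X\times X,\nu\times\nu)$ is ergodic. Group cohomology $H^n(G,M)$ for a left $G$-module $M$ is defined via inhomogeneous cochains $G^n\to M$ with the standard coboundary $(\delta c)(g_1,\dots,g_{n+1})=g_1c(g_2,\dots,g_{n+1})+\sum_{i=1}^n(-1)^ic(g_1,\dots,g_ig_{i+1},\dots,g_{n+1})+(-1)^{n+1}c(g_1,\dots,g_n)$; $\mathbb{T}$ carries the trivial $G$-action, so $H^1(G,\mathbb{T})=\mathrm{Hom}(G,\mathbb{T})$.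 For a p.m.p. action $G\curvearrowright(X,\mu)$, a measurable map $c:G^n\times X\to\mathbb{T}$ is an $n$-cocycle if for all $g_1,\dots,g_{n+1}\in G$ and $\mu$-a.e. $x$: $c(g_2,\dots,g_{n+1},g_1^{-1}x)\prod_{i=1}^n c(g_1,\dots,g_ig_{i+1},\dots,g_{n+1},x)^{(-1)^i}\cdot c(g_1,\dots,g_n,x)^{(-1)^{n+1}}=1$. Two $n$-cocycles $c_1,c_2$ are cohomologous if there is a measurable $b:G^{n-1}\times X\to\mathbb{T}$ with, for all $g_i$ and a.e. $x$, $c_1(g_1,\dots,g_n,x)\,b(g_2,\dots,g_n,g_1^{-1}x)\prod_{i=1}^{n-1}b(g_1,\dots,g_ig_{i+1},\dots,g_n,x)^{(-1)^i}\cdot b(g_1,\dots,g_{n-1},x)^{(-1)^n}=c_2(g_1,\dots,g_n,x)$. $H^n(G\curvearrowright X;\mathbb{T})$ is the abelian group (pointwise multiplication) of $n$-cocycles modulo those cohomologous to the constant $1$. The natural map $\Psi_n:H^n(G,\mathbb{T})\to H^n(G\curvearrowright X;\mathbb{T})$ sends $[c]$ to the class of $(g_1,\dots,g_n,x)\mapsto c(g_1,\dots,g_n)$. *)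

(* Defs.v *)
From HB Require Import structures.
From mathcomp Require Import all_boot all_order all_algebra.
From mathcomp Require Import all_classical all_reals all_analysis.

Set Implicit Arguments.
Unset Strict Implicit.
Unset Printing Implicit Defensive.

Import Order.TTheory GRing.Theory Num.Theory.
Import numFieldNormedType.Exports.
Local Open Scope classical_set_scope.
Local Open Scope ring_scope.

Record group_law (G : Type) := GroupLaw {
  gmul : G -> G -> G;
  gone : G;
  ginv : G -> G;
  gmulA : forall a b c, gmul a (gmul b c) = gmul (gmul a b) c;
  gmul1g : forall a, gmul gone a = a;
  gmulVg : forall a, gmul (ginv a) a = gone }.

(* The circle T = R/Z.  An element of T is represented by a real lift;  *)
(* two lifts represent the same point iff they differ by an integer.    *)
Definition eqT {R : realType} (a b : R) : Prop := (a - b) \is a Num.int.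

Definition Borel (X : topologicalZmodType) : Type := X.
Section borel_instance.
Variable X : topologicalZmodType.
HB.instance Definition _ := Choice.on (Borel X).
HB.instance Definition _ := isPointed.Build (Borel X) (0 : X).
HB.instance Definition _ := @isMeasurable.Build (sigma_display (@open X))
  (Borel X) <<s (@open X : set (set (Borel X))) >>
  (@sigma_algebra0 _ setT _) (@sigma_algebraC (Borel X) _)
  (@sigma_algebra_bigcup _ setT _).
End borel_instance.

(* A map X -> T (given by lifts f : X -> R) is Borel measurable iff its  *)
(* composition with the embedding T -> C, t |-> exp(2 pi i t), is, i.e.  *)
(* iff both the real and imaginary parts are measurable.                 *)
Definition Tmeasurable {R : realType} {X : topologicalZmodType} (f : X -> R) : Prop :=
  measurable_fun (setT : set (Borel X)) (fun x : Borel X => cos (2 * pi * f x)) /\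
  measurable_fun (setT : set (Borel X)) (fun x : Borel X => sin (2 * pi * f x)).

(* Continuity of a map X -> T (topology of T as a subspace of C). *)
Definition Tcontinuous {R : realType} {X : topologicalType} (f : X -> R) : Prop :=
  continuous (fun x : X => cos (2 * pi * f x)) /\
  continuous (fun x : X => sin (2 * pi * f x)).

Definition character {R : realType} {X : topologicalZmodType} (chi : X -> R) : Prop :=
  (forall x y : X, eqT (chi (x + y)) (chi x + chi y)) /\ Tcontinuous chi.

Definition metrizable (R : realType) (X : topologicalType) : Prop :=
  exists d : X -> X -> R,
    [/\ (forall x y, 0 <= d x y),
        (forall x y, d x y = 0 <-> x = y),
        (forall x y, d x y = d y x),
        (forall x y z, d x z <= d x y + d y z) &
        (forall A : set X, open A <->
           (forall x, A x -> exists2 e : R, 0 < e & [set y | d x y < e] `<=` A))].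

Definition haar_probability {R : realType} {X : topologicalZmodType}
    (nu : probability (Borel X) R) : Prop :=
  forall (a : X) (A : set (Borel X)), measurable A ->
    nu ((fun y : Borel X => (y : X) + a) @^-1` A) = nu A.

Definition algebraic_action {G : Type} (L : group_law G) {X : topologicalZmodType}
    (sigma : G -> X -> X) : Prop :=
  [/\ (forall g x y, sigma g (x + y) = sigma g x + sigma g y),
      (forall g, continuous (sigma g)),
      (forall g, bijective (sigma g)),
      (forall g h x, sigma (gmul L g h) x = sigma g (sigma h x)) &
      (forall x, sigma (gone L) x = x)].

Definition weakly_mixing {R : realType} {G : Type} (L : group_law G)
    {X : topologicalZmodType} (nu : probability (Borel X) R) (sigma : G -> X -> X) : Prop :=
  forall A : set (Borel X * Borel X), measurable A ->
    (forall g, (fun p : Borel X * Borel X => ((sigma g p.1 : Borel X), (sigma g p.2 : Borel X))) @^-1` A = A) ->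
    ((nu \x nu) A = 0 \/ (nu \x nu) A = 1)%E.

(* H^1(G,T) = Hom(G,T) (trivial action, no nonzero 1-coboundaries). *)
Definition homT {R : realType} {G : Type} (L : group_law G) (chi : G -> R) : Prop :=
  forall g h, eqT (chi (gmul L g h)) (chi g + chi h).

Definition H1T_eq {R : realType} {G : Type} (chi1 chi2 : G -> R) : Prop :=
  forall g, eqT (chi1 g) (chi2 g).

(* 1-cocycles G -> \hat X, where (g chi)(x) = chi (g^{-1} x):            *)
(*   c (g1 g2) = c g1 + g1 . c g2.   c g is given by lifts X -> R.        *)
Definition dual_cocycle {R : realType} {G : Type} (L : group_law G) {X : topologicalZmodType}
    (sigma : G -> X -> X) (c : G -> X -> R) : Prop :=
  (forall g, character (c g)) /\
  (forall g1 g2 x, eqT (c (gmul L g1 g2) x) (c g1 x + c g2 (sigma (ginv L g1) x))).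

Definition dual_cohomologous {R : realType} {G : Type} (L : group_law G) {X : topologicalZmodType}
    (sigma : G -> X -> X) (c1 c2 : G -> X -> R) : Prop :=
  exists xi : X -> R, character xi /\
    forall g x, eqT (c1 g x - c2 g x) (xi (sigma (ginv L g) x) - xi x).

Definition action_cocycle {R : realType} {G : Type} (L : group_law G) {X : topologicalZmodType}
    (nu : probability (Borel X) R) (sigma : G -> X -> X) (c : G -> X -> R) : Prop :=
  (forall g, Tmeasurable (c g)) /\
  (forall g1 g2, {ae nu, forall x : Borel X,
      eqT (c g2 (sigma (ginv L g1) x) - c (gmul L g1 g2) x + c g1 x) 0}).

Definition action_cohomologous {R : realType} {G : Type} (L : group_law G) {X : topologicalZmodType}
    (nu : probability (Borel X) R) (sigma : G -> X -> X) (c1 c2 : G -> X -> R) : Prop :=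
  exists b : X -> R, Tmeasurable b /\
    forall g, {ae nu, forall x : Borel X,
      eqT (c1 g x + b (sigma (ginv L g) x) - b x) (c2 g x)}.

Definition Psi1 {R : realType} {G : Type} {X : Type} (chi : G -> R) : G -> X -> R :=
  fun g _ => chi g.

Definition quot_eq {R : realType} {G : Type} (L : group_law G) {X : topologicalZmodType}
    (nu : probability (Borel X) R) (sigma : G -> X -> X) (c1 c2 : G -> X -> R) : Prop :=
  exists chi : G -> R, homT L chi /\
    action_cohomologous L nu sigma c1 (fun g x => c2 g x + Psi1 chi g x).

(* Main.v *)
(* Let c(g) + b(g^-1 x) - b(x) = chi(g) a.e., with each c(g) a character and  *)

(* Three facts carry this argument. By [haar_almost_continuous], a small translation changes a
   measurable circle-valued function little in measure. By [near_diagonal_nonnull], a set that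
   contains all pairs close in X with close values of b therefore has positive measure. By
   [zero_one], weak mixing makes such a set conull once it is invariant. Closeness at every scale
   1/(n+1) then becomes equality.

   For b(x) - b(x') itself this gives [weakly_mixing_eigenvalue_trivial], hence the injectivity of
   Psi_1. For the law of the second difference of b it gives [weakly_mixing_character], where
   [constant_increment_all] and [constant_increment_character] produce psi; applied to the
   difference of two cocycles, this is the injectivity of Phi_1. The remaining claims are pointwise
   identities. Since circle values are real lifts, equality in the circle is integrality of a
   difference, and closeness to 0 is a cosine close to 1. *)
(* b : X -> T measurable.  For (x, x') in X^2, the law under nu of             *)
(*   y |-> (b(x + y) - b(x' + y)) - (b(x) - b(x'))                             *)
(* is invariant under the diagonal action, since c and chi cancel out; by      *)
(* ergodicity of X^2 it is a.e. constant.  It concentrates near 0 when x is    *)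
(* close to x', because translations of a measurable function are continuous   *)
(* in measure, so it is the Dirac mass at 0: for almost every, hence for       *)
(* every, t the increment b(y + t) - b(y) is a.e. equal to a constant psi(t).  *)
(* This psi is a continuous character, and comparing the cocycle equation at x *)
(* and at x + t gives c(g)(t) = psi(t) - psi(g^-1 t).  Injectivity of Psi_1 is *)
(* the case of the invariant function b(x) - b(x') on X^2.                     *)
Require Import Defs.
From HB Require Import structures.
From mathcomp Require Import all_boot all_order all_algebra.
From mathcomp Require Import all_classical all_reals all_analysis.
From mathcomp Require Import finmap measurable_realfun ring lra.
Import Order.TTheory GRing.Theory Num.Theory.
Import numFieldNormedType.Exports.
Local Open Scope classical_set_scope.
Local Open Scope ring_scope.

Set Implicit Arguments.
Unset Strict Implicit.

(* [compact_cover] is stated for pointed spaces only. *)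
Definition based (X : topologicalZmodType) : Type := X.
HB.instance Definition _ (X : topologicalZmodType) := Topological.on (based X).
HB.instance Definition _ (X : topologicalZmodType) :=
  isPointed.Build (based X) (0 : X).

(** * Second countability and Borel sets of the square *)

Lemma compact_cover_zmod (X : topologicalZmodType) (A : set X) :
  compact A -> cover_compact A.
Proof. by move=> cA; have : @compact (based X) A by []; rewrite compact_cover. Qed.

(** For each n, compactness gives a finite 1/(n+1)-net; the balls of that radius about its points,
    over all n, form a countable base. *)
Lemma compact_metrizable_second_countable (R : realType)
    (X : topologicalZmodType) :
  compact [set: X] -> metrizable R X -> @second_countable X.
Proof.
move=> cX [d [d0 d_eq0 dC dtri dopen]].
have ball_open (x : X) (e : R) : open [set y | d x y < e].
  apply/dopen => y /= xye; exists (e - d x y); first by rewrite subr_gt0.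
  by move=> z /=; rewrite ltrBrDl; apply: le_lt_trans; exact: dtri.
have dxx (x : X) : d x x = 0 by exact/d_eq0.
pose r (n : nat) : R := n.+1%:R^-1.
have r0 n : 0 < r n by rewrite invr_gt0.
have fcov n : finite_subset_cover [set: X] (fun x => [set y | d x y < r n]) [set: X].
  apply: (compact_cover_zmod cX) => // x _.
  by exists x => //=; rewrite dxx.
have /choice[F FP] n : exists F : {fset X}, forall x, exists2 p, p \in F & d p x < r n.
  have [F _ cF] := fcov n; exists F => x.
  by have [p /= pF px] := cF x I; exists p.
exists (\bigcup_n [set [set y | d p y < r n] | p in [set` F n]]).
  by apply: bigcup_countable => // n _; exact/finite_set_countable/finite_image/finite_fset.
split; first by move=> _ [n _ [p _ <-]].
move=> x V; rewrite nbhsE => -[W [Wo Wx] WV].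
have [e e0 eW] := (dopen W).1 Wo x Wx.
have [n /= ne] : exists n, r n < e / 2.
  have [n] := @ltr_add_invr R 0 (e / 2) (divr_gt0 e0 (ltr0Sn _ _)).
  by rewrite add0r => ?; exists n.
have [p pF px] := FP n x.
exists [set y | d p y < r n] => /=; first by split => //; exists n => //; exists p.
move=> y /= py; apply/WV/eW => /=; rewrite (splitr e).
by apply: le_lt_trans (dtri x p y) _; rewrite ltrD// ?(lt_trans _ ne)// dC.
Qed.

(** Measurability here refers to the product sigma-algebra; a countable base makes every open set a
    countable union of open rectangles. This yields joint measurability of addition. *)
Lemma open_prod_measurable (X : topologicalZmodType) (W : set (X * X)) :
  @second_countable X -> open W -> measurable (W : set (Borel X * Borel X)).
Proof.
move=> [B cB [Bo Bb]] Wo.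
pose C := [set P : set X * set X | [/\ B P.1, B P.2 & P.1 `*` P.2 `<=` W]].
have -> : W = \bigcup_(P in C) (P.1 `*` P.2).
  apply/seteqP; split => [[x y] Wxy|p [P [_ _ PW]] /PW//].
  have [[U V] /= [Ux Vy] UVW] := open_nbhs_nbhs (conj Wo Wxy).
  have [U' [BU' U'x] U'U] := Bb x U Ux.
  have [V' [BV' V'y] V'V] := Bb y V Vy.
  exists (U', V') => //; split => //= -[a b] /= [/U'U ? /V'V ?].
  exact: UVW.
have cC : countable C.
  apply: (sub_countable (B := B `*` B)); last exact: countableX.
  by apply: subset_card_le => P [].
rewrite bigcup_set_type; apply: countable_bigcupT_measurable.
  by rewrite (eq_countable (card_setT C)).
case=> P /set_mem[BU BV _] /=.
by apply: measurableX; apply: sub_sigma_algebra; exact: Bo.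
Qed.

(** * The circle as reals modulo integers *)

Lemma eq_int (R : realType) (a b : R) : a \is a Num.int -> a = b -> b \is a Num.int.
Proof. by move=> + <-. Qed.

Lemma cos_2pi_int (R : realType) (a : R) : a \is a Num.int -> cos (2 * pi * a) = 1.
Proof.
move=> /intrP[z ->]; rewrite mulrC mulr_natl; case: z => n.
  by rewrite -[X in cos X]add0r mulr_natl (periodicn (@cosD2pi R)) cos0.
by rewrite NegzE mulrNz mulNr cosN -[X in cos X]add0r mulr_natl
  (periodicn (@cosD2pi R)) cos0.
Qed.

Lemma sin_2pi_int (R : realType) (a : R) : a \is a Num.int -> sin (2 * pi * a) = 0.
Proof. by move=> /cos_2pi_int aZ; apply: cos1sin0; rewrite aZ normr1. Qed.

Lemma eqT_cos (R : realType) (a b : R) : eqT a b -> cos (2 * pi * a) = cos (2 * pi * b).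
Proof.
move=> ab; rewrite -(subrK b a) mulrDr cosD.
by rewrite (cos_2pi_int ab) (sin_2pi_int ab) mul1r mul0r subr0.
Qed.

(** The fractional part r of a satisfies sin (pi r) = 0 by the double-angle formula, while sin is
    positive on (0, pi). *)
Lemma cos_2pi_eq1 (R : realType) (a : R) : cos (2 * pi * a) = 1 -> a \is a Num.int.
Proof.
move=> a1; pose r := a - (Num.floor a)%:~R.
have fZ : (Num.floor a)%:~R \is a @Num.int R by rewrite intr_int.
have r1 : cos (2 * pi * r) = 1.
  by rewrite (@eqT_cos _ r a)//; rewrite /eqT /r addrAC subrr sub0r rpredN.
have sr : sin (pi * r) = 0.
  apply/eqP; rewrite -sqrf_eq0; move: r1.
  rewrite -mulrA mulr_natl cos_mulr2n cos2sin2 => r1; apply/eqP; lra.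
have /andP[r0 rlt1] : 0 <= r < 1.
  by rewrite /r subr_ge0 ltrBlDl floor_le/= -intrD1 floorD1_gt.
have [r_eq0|rn0] := eqVneq r 0; first by rewrite -(subrK (Num.floor a)%:~R a) -/r r_eq0 add0r.
suff: 0 < sin (pi * r) by rewrite sr ltxx.
apply: sin_gt0_pi; have p0 := @pi_gt0 R.
have rgt0 : 0 < r by rewrite lt_neqAle eq_sym rn0.
by rewrite mulr_gt0//= gtr_pMr.
Qed.

(* For unit complex numbers [u, v] this is [|u + v - 2|^2 >= 0]. *)
Lemma cosB_ge (R : realType) (x y : R) : 2 * cos x + 2 * cos y - 3 <= cos (x - y).
Proof.
rewrite cosB; have := cos2Dsin2 x; have := cos2Dsin2 y.
by have := sqr_ge0 (cos x + cos y - 2); have := sqr_ge0 (sin x + sin y); nra.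
Qed.

(** * Almost-everywhere statements and null sets of product measures *)

Section measure_preliminaries.
Context d (T : measurableType d) (R : realType).

Lemma ae_comp (P : probability T R) (s : T -> T) (Q : T -> Prop) :
  measurable_fun setT s ->
  (forall A, measurable A -> P (s @^-1` A) = P A) ->
  {ae P, forall x, Q x} -> {ae P, forall x, Q (s x)}.
Proof.
move=> ms sP [N [mN N0 QN]]; exists (s @^-1` N); split.
- by rewrite -[X in measurable X]setTI; exact: ms.
- by rewrite sP.
- by move=> x /= nQ; apply: QN.
Qed.

Lemma ae_exists (P : probability T R) (Q : T -> Prop) :
  {ae P, forall x, Q x} -> exists x, Q x.
Proof.
move=> [N [mN N0 QN]]; apply: contrapT => nQ.
have : N = setT.
  by apply/seteqP; split => // x _; apply: QN => /= Qx; apply: nQ; exists x.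
by move=> NT; move: N0; rewrite NT probability_setT => /eqP; rewrite onee_eq0.
Qed.

Lemma ae_probability1 (P : probability T R) (A : set T) : measurable A ->
  (P A = 1)%E <-> {ae P, forall x, A x}.
Proof.
move=> mA; have PA : P A \is a fin_num by exact: fin_num_measure.
have mCA : measurable (~` A) by exact: measurableC.
have PC := probability_setC P mA; split => [PA1|/(negligibleP P mCA)].
  by apply/(negligibleP P mCA)/(etrans PC); rewrite PA1 subee.
move=> PC0; have := etrans (esym PC) PC0; case: (P A) PA => // r _ /eqP.
by rewrite -EFinB eqe subr_eq0 eq_sym => /eqP ->.
Qed.

Variables (P : probability T R) (d' : measure_display) (T' : measurableType d')
  (Q : probability T' R) (A : set (T * T')) (mA : measurable A).

Lemma product_measure_sym : ((P \x Q) A = (P \x^ Q) A)%E.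
Proof. by apply: product_measure_unique => // B C mB mC; exact: product_measure2E. Qed.

Lemma null_xsection :
  ((P \x Q) A = 0)%E <-> {ae P, forall x, Q (xsection A x) = 0%E}.
Proof.
have mf := measurable_fun_xsection Q mA.
have -> : ((P \x Q) A = \int[P]_x `|(Q \o xsection A) x|)%E.
  by apply: eq_integral => x _; rewrite gee0_abs.
rewrite (ae_eq_integral_abs P measurableT mf).
by split; apply: filterS => x /=; [apply|move=> + _].
Qed.

Lemma null_ysection :
  ((P \x Q) A = 0)%E <-> {ae Q, forall y, P (ysection A y) = 0%E}.
Proof.
have mf := measurable_fun_ysection P mA.
have -> : ((P \x Q) A = \int[Q]_y `|(P \o ysection A) y|)%E.
  by rewrite product_measure_sym; apply: eq_integral => y _; rewrite gee0_abs.
rewrite (ae_eq_integral_abs Q measurableT mf).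
by split; apply: filterS => x /=; [apply|move=> + _].
Qed.

End measure_preliminaries.

(** * Borel measurability of continuous maps and of addition *)

Section borel.
Context (R : realType) (X : topologicalZmodType).

Lemma borel_open (A : set X) : open A -> measurable (A : set (Borel X)).
Proof. exact: sub_sigma_algebra. Qed.

Lemma borel_continuous (f : X -> X) :
  continuous f -> measurable_fun setT (f : Borel X -> Borel X).
Proof.
move=> /continuousP cf; apply: (@measurability _ _ _ (Borel X) _ _ (@open X) erefl) => _ [A oA <-].
by rewrite setTI; apply: borel_open; exact: cf.
Qed.

Lemma borel_continuous_real (f : X -> R) :
  continuous f -> measurable_fun setT (f : Borel X -> R).
Proof.
move=> /continuousP cf; apply: (@measurability _ _ (Borel X) R setT f _ (RGenOInfty.measurableE R)).
move=> _ [_ [a ->] <-]; rewrite setTI; apply: borel_open; apply: cf.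
exact: interval_open.
Qed.

Lemma borel_add : @second_countable X ->
  measurable_fun setT (fun p : Borel X * Borel X => ((p.1 : X) + p.2 : Borel X)).
Proof.
move=> scX; apply: (@measurability _ _ _ (Borel X) _ _ (@open X) erefl) => _ [A oA <-].
rewrite setTI; apply: (@open_prod_measurable X) => //.
by move/continuousP : (@add_continuous X); apply.
Qed.

Lemma add_cst_continuous (a : X) : continuous (fun x : X => x + a).
Proof.
move=> x; apply: (@continuous_comp _ _ _ (fun y => (y, a)) (fun p : X * X => p.1 + p.2)).
  by apply: cvg_pair => /=; [exact: cvg_id|exact: cvg_cst].
exact: add_continuous.
Qed.

Lemma cst_sub_continuous (a : X) : continuous (fun x : X => a - x).
Proof.
move=> x; apply: (@continuous_comp _ _ _ (fun y => (a, y)) (fun p : X * X => p.1 - p.2)).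
  by apply: cvg_pair => /=; [exact: cvg_cst|exact: cvg_id].
exact: sub_continuous.
Qed.

End borel.

(** * Haar measure: automorphisms and continuity of translations *)

Lemma measure_bigcap_set0 d (T : measurableType d) (R : realType)
    (P : probability T R) (F : (set T)^nat) (e : R) :
  (forall n, measurable (F n)) -> nonincreasing_seq F -> \bigcap_n F n = set0 ->
  0 < e -> exists n, (P (F n) <= e%:E)%E.
Proof.
move=> mF niF F0 e0.
have : P \o F @ \oo --> P (\bigcap_n F n).
  apply: nonincreasing_cvg_mu => //; last exact: bigcapT_measurable.
  exact: le_lt_trans (probability_le1 P (mF 0%N)) (ltry _).
rewrite F0 measure0 => /fine_cvgP[_] /cvgr_le /(_ e e0) [n _ /(_ n (leqnn n)) /=] Fne.
by exists n; rewrite -(@fineK _ (P (F n))) ?lee_fin// fin_num_measure.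
Qed.

Section haar.
Context (R : realType) (X : topologicalZmodType).
Variables (cX : compact [set: X]) (mX : metrizable R X).
Variables (nu : probability (Borel X) R) (nu_haar : haar_probability nu).

Let scX : @second_countable X := compact_metrizable_second_countable cX mX.

(* Integrate the indicator of [s x + y \in A] in both orders (this is the   *)
(* uniqueness of the Haar probability).                                     *)
Lemma haar_automorphism (s : X -> X) (A : set (Borel X)) :
  (forall x y, s (x + y) = s x + s y) -> continuous s ->
  (forall y, exists x, s x = y) -> measurable A -> nu (s @^-1` A) = nu A.
Proof.
move=> sD cs ss mA.
have ms := borel_continuous cs.
have msA : measurable (s @^-1` A : set (Borel X)).
  by rewrite -[X in measurable X]setTI; exact: ms.
pose M := [set p : Borel X * Borel X | A (s p.1 + (p.2 : X))].
have mM : measurable M.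
  rewrite -[X in measurable X]setTI.
  have : measurable_fun setT (fun p : Borel X * Borel X => (s p.1 + (p.2 : X) : Borel X)).
    apply: (measurableT_comp (borel_add scX)
      (g := fun p : Borel X * Borel X => (s p.1 : Borel X, p.2))).
    by apply: measurable_fun_pair => //; exact: measurableT_comp.
  exact.
have M1 : ((nu \x nu) M = nu A)%E.
  rewrite -[RHS]mule1 -(probability_setT nu) -integral_cst//.
  apply: eq_integral => x _ /=; rewrite -(nu_haar (s x) mA); congr (nu _).
  apply/seteqP; split => [y /xsectionP|y Ay]; first by rewrite /M /= addrC.
  by apply/xsectionP; rewrite /M /= addrC.
rewrite -M1 product_measure_sym//.
rewrite -[LHS]mule1 -(probability_setT nu) -integral_cst//.
apply: eq_integral => y _ /=; have [y' y'E] := ss y.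
rewrite -(nu_haar y' msA); congr (nu _).
apply/seteqP; split => [x Ax|x /ysectionP]; last by rewrite /M /= -y'E -sD.
by apply/ysectionP; rewrite /M /= -y'E -sD.
Qed.

Lemma borel_translate (A : set (Borel X)) (t : X) : measurable A ->
  measurable [set y : Borel X | A ((y : X) + t)].
Proof.
move=> mA; rewrite -[X in measurable X]setTI.
exact: (borel_continuous (@add_cst_continuous X t)).
Qed.

Lemma ae_translate (Q : X -> Prop) (t : X) :
  {ae nu, forall x : Borel X, Q x} -> {ae nu, forall x : Borel X, Q ((x : X) + t)}.
Proof.
apply: ae_comp; first exact: (borel_continuous (@add_cst_continuous X t)).
by move=> A mA; exact: nu_haar.
Qed.

(** One half of the symmetric difference suffices: A and its translate have equal measure, so both
    halves have the same mass. *)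
Let translation_continuous (A : set (Borel X)) := forall e : R, 0 < e ->
  exists U : set X, [/\ open U, U 0 & forall t, U t ->
    (nu (A `\` [set y : Borel X | A ((y : X) + t)%R]) <= e%:E)%E].

(** A point of an open set stays inside under small translations, so the points that some t in [U n]
    moves out of A form sets decreasing to the empty set. *)
Let translation_continuous_open (A : set X) : open A -> translation_continuous A.
Proof.
move=> oA e e0; have [d [d0 d_eq0 dC dtri dopen]] := mX.
pose U n := [set x | d 0 x < n.+1%:R^-1].
have U0 n : U n 0 by rewrite /U /= (d_eq0 0 0).2// invr_gt0.
have oU n : open (U n).
  apply/dopen => y /= xye; exists (n.+1%:R^-1 - d 0 y); first by rewrite subr_gt0.
  by move=> z /=; rewrite ltrBrDl; apply: le_lt_trans; exact: dtri.
pose F : (set (Borel X))^nat := fun n => [set y : X | A y /\ exists2 t, U n t & ~ A (y + t)].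
have mA : measurable (A : set (Borel X)) by exact: borel_open.
have mF n : measurable (F n : set (Borel X)).
  (* Indexing by the endpoint a = y + t outside A shows [F n] to be open. *)
  have -> : F n = A `&` \bigcup_(a in ~` A) [set y | U n (a - y)].
    apply/seteqP; split => y [Ay].
      by move=> [t Ut At]; split => //; exists (y + t) => //=; rewrite addrAC subrr add0r.
    by move=> [a Aa /= Ua]; split => //; exists (a - y) => //; rewrite addrC subrK.
  apply: measurableI => //; apply: borel_open; apply: bigcup_open => a _.
  by move/continuousP: (@cst_sub_continuous X a); exact.
have [n Fn] : exists n, (nu (F n) <= e%:E)%E.
  apply: (measure_bigcap_set0 nu mF _ _ e0).
    move=> m n mn; apply/subsetPset => y [Ay [t Ut At]]; split => //; exists t => //.
    by apply: lt_le_trans Ut _; rewrite lef_pV2 ?posrE// ler_nat.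
  rewrite -subset0 => y /= Fy; have [Ay _] := Fy 0%N I.
  have : open [set t | A (y + t)].
    move/continuousP: (@add_cst_continuous X y) => /(_ _ oA).
    by congr open; apply/seteqP; split => t; rewrite /= addrC.
  move=> /dopen /(_ 0); rewrite /= addr0 => /(_ Ay)[r r0 rA].
  have [n] := @ltr_add_invr R 0 r r0; rewrite add0r => nr.
  have [_ [t Ut]] := Fy n I; apply; apply: rA => /=; exact: lt_trans Ut nr.
exists (U n); split => // t Ut; apply: le_trans Fn.
apply: le_measure; [|exact: mem_set|].
  by apply/mem_set/measurableD => //; exact: borel_translate.
by move=> y [Ay At]; split => //; exists t.
Qed.

Let translation_continuousC (A : set (Borel X)) :
  measurable A -> translation_continuous A -> translation_continuous (~` A).
Proof.
move=> mA cA e e0; have [U [oU U0 UA]] := cA e e0; exists U; split => // t Ut.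
apply: le_trans (UA t Ut); rewrite le_eqVlt; apply/orP; left; apply/eqP.
set B := [set y : Borel X | A ((y : X) + t)].
have mB : measurable B by exact: borel_translate.
have -> : ~` A `\` [set y : Borel X | (~` A) ((y : X) + t)] = B `\` A.
  apply/seteqP; split => y; rewrite /B /=.
    by move=> [nAy nnA]; split => //; exact: contrapT.
  by move=> [By nA]; split.
rewrite !measureD//; last 2 first.
  exact: le_lt_trans (probability_le1 nu mA) (ltry _).
  exact: le_lt_trans (probability_le1 nu mB) (ltry _).
have nuB : nu B = nu A := nu_haar t mA. by rewrite setIC; congr (_ - _)%E.
Qed.

Let translation_continuousU (A B : set (Borel X)) : measurable A -> measurable B ->
  translation_continuous A -> translation_continuous B -> translation_continuous (A `|` B).
Proof.
move=> mA mB cA cB e e0; have e20 : 0 < e / 2 by rewrite divr_gt0.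
have [U [oU U0 UA]] := cA _ e20; have [V [oV V0 VB]] := cB _ e20.
exists (U `&` V); split => //; first exact: openI.
move=> t [Ut Vt]; rewrite (splitr e) EFinD.
apply: le_trans (leeD (UA t Ut) (VB t Vt)).
have mt (C : set (Borel X)) : measurable C -> measurable (C `\` [set y : Borel X | C ((y : X) + t)]).
  by move=> mC; apply: measurableD => //; exact: borel_translate.
apply: le_trans (measureU2 _ (mt _ mA) (mt _ mB)).
apply: le_measure; [by apply: mem_set; apply: mt; exact: measurableU|by apply: mem_set; apply: measurableU; exact: mt|].
by move=> y [[Ay|By] /= /not_orP[nA nB]]; [left|right].
Qed.

(** The sets with this property form a sigma-algebra containing the open sets. *)
Lemma haar_translation_continuous (A : set (Borel X)) : measurable A ->
  forall e : R, 0 < e -> exists U : set X, [/\ open U, U 0 & forall t, U t ->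
    (nu (A `\` [set y : Borel X | A ((y : X) + t)%R]) <= e%:E)%E].
Proof.
move=> mA0; suff /(_ _ mA0)[] : measurable `<=` [set A | measurable A /\ translation_continuous A] by [].
apply: smallest_sub; last by move=> B oB; split; [exact: borel_open|exact: translation_continuous_open].
split.
- split => // e e0; exists setT; split => //; first exact: openT.
  by move=> t _; rewrite set0D measure0 lee_fin ltW.
- move=> B [mB cB]; rewrite setTD; split; first exact: measurableC.
  exact: translation_continuousC.
- move=> F mcF; have mF n : measurable (F n) := (mcF n).1.
  have mUF : measurable (\bigcup_n F n) by exact: bigcupT_measurable.
  split=> // e e0; have e20 : 0 < e / 2 by rewrite divr_gt0.
  (* The part of the union missed by the first n sets decreases to the empty set; half of e pays for
     it, the other half for the finite union. *)
  pose H n := \bigcup_n F n `\` \big[setU/set0]_(i < n) F i.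
  have mS n : measurable (\big[setU/set0]_(i < n) F i) by exact: bigsetU_measurable.
  have [n Hn] : exists n, (nu (H n) <= (e / 2)%:E)%E.
    apply: measure_bigcap_set0 => //; first by move=> n; exact: measurableD.
      move=> m n mn; apply/subsetPset => y [Fy nF]; split => // Fm; apply: nF.
      by apply: subset_bigsetU Fm.
    rewrite -subset0 => y /= Hy; have [[i _ Fiy] _] := Hy 0%N I.
    have [_] := Hy i.+1 I; apply; exact: (bigsetU_sup (ltnSn i)).
  have cS : translation_continuous (\big[setU/set0]_(i < n) F i).
    elim: n {Hn} => [|n IH].
      rewrite big_ord0 => r r0; exists setT; split => //; first exact: openT.
      by move=> t _; rewrite set0D measure0 lee_fin ltW.
    by rewrite big_ord_recr; exact: translation_continuousU (mS n) (mF n) IH (mcF n).2.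
  have [U [oU U0 US]] := cS _ e20; exists U; split => // t Ut.
  rewrite (splitr e) EFinD; apply: le_trans (leeD Hn (US t Ut)).
  have mt : measurable (\big[setU/set0]_(i < n) F i `\`
      [set y : Borel X | (\big[setU/set0]_(i < n) F i) ((y : X) + t)]).
    by apply: measurableD => //; exact: borel_translate.
  have mH : measurable (H n) by exact: measurableD.
  apply: le_trans (measureU2 _ mH mt).
  apply: le_measure; [|exact/mem_set/measurableU|].
    by apply/mem_set/measurableD => //; exact: borel_translate.
  move=> y [Fy nFy]; have [Sy|nSy] := pselect ((\big[setU/set0]_(i < n) F i) y).
    by right; split => // Sty; apply: nFy; exact: (bigsetU_bigcup Sty).
  by left.
Qed.

End haar.

(** * Measurable circle-valued maps *)

Section circle_measurable.
Context (R : realType).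

(** This extends [Tmeasurable], with which it agrees on X, to maps on powers of X. *)
Definition circle_measurable d (Z : measurableType d) (f : Z -> R) :=
  measurable_fun setT (fun z => cos (2 * pi * f z)) /\
  measurable_fun setT (fun z => sin (2 * pi * f z)).

Lemma circle_measurableB d (Z : measurableType d) (f g : Z -> R) :
  circle_measurable f -> circle_measurable g ->
  circle_measurable (fun z => f z - g z).
Proof.
move=> [cf sf] [cg sg]; split.
  under eq_fun do rewrite mulrBr cosB.
  by apply: measurable_funD; exact: measurable_funM.
under eq_fun do rewrite mulrBr sinB.
by apply: measurable_funB; exact: measurable_funM.
Qed.

Lemma circle_measurable_comp d d' (Z : measurableType d) (Y : measurableType d')
    (f : Y -> R) (p : Z -> Y) :
  circle_measurable f -> measurable_fun setT p -> circle_measurable (f \o p).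
Proof. by move=> [cf sf] mp; split; [exact: measurableT_comp cf mp|exact: measurableT_comp sf mp]. Qed.

Lemma measurable_le_set d (Z : measurableType d) (f g : Z -> R) :
  measurable_fun setT f -> measurable_fun setT g -> measurable [set z | f z <= g z].
Proof.
move=> /measurable_EFinP mf /measurable_EFinP mg.
by have := measurable_lee measurableT mf mg; rewrite setTI.
Qed.

Lemma measurable_cos_le d (Z : measurableType d) (f : Z -> R) (r : R) :
  circle_measurable f -> measurable [set z | cos (2 * pi * f z) <= r].
Proof. by move=> [cf _]; exact: measurable_le_set. Qed.

Lemma measurable_cos_gt d (Z : measurableType d) (f : Z -> R) (r : R) :
  circle_measurable f -> measurable [set z | r < cos (2 * pi * f z)].
Proof.
move=> /(measurable_cos_le r)/measurableC; congr measurable.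
by apply/seteqP; split => z /=; rewrite ltNge => /negP.
Qed.

End circle_measurable.

(** * Continuity in measure of circle-valued functions under translation *)

Section haar_almost_continuity.
Context (R : realType) (X : topologicalZmodType).
Variables (cX : compact [set: X]) (mX : metrizable R X).
Variables (nu : probability (Borel X) R) (nu_haar : haar_probability nu).

(** By compactness finitely many translates of U cover X, so U null would make X null. *)
Lemma haar_open_nonnull (U : set X) : open U -> U 0 ->
  ~ {ae nu, forall t : Borel X, ~ U t}.
Proof.
move=> oU U0 nU.
have [F _ FU] : finite_subset_cover [set: X] (fun x => [set y : X | U (y - x)]) [set: X].
  apply: (compact_cover_zmod cX) => [x _|x _]; last by exists x => //=; rewrite subrr.
  by move/continuousP: (@add_cst_continuous X (- x)); exact.
have nUF x : x \in F -> {ae nu, forall y : Borel X, ~ U ((y : X) - x)}.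
  by move=> _; exact: (ae_translate nu_haar (Q := fun t => ~ U t)).
have /ae_exists[y yU] : {ae nu, forall y : Borel X,
    (\bigcap_(x in [set` F]) [set y : Borel X | ~ U ((y : X) - x)]) y}.
  exact: filter_bigI nUF.
by have [x xF] := FU y I; exact: yU.
Qed.

Let haar_translation_continuous_seq (F : (set (Borel X))^nat) n (e : R) :
  (forall i, measurable (F i)) -> 0 < e ->
  exists U : set X, [/\ open U, U 0 & forall t, U t ->
    (nu (\big[setU/set0]_(i < n) (F i `\` [set y : Borel X | F i ((y : X) + t)%R]))
      <= e%:E)%E].
Proof.
move=> mF; elim: n e => [|n IH] e e0.
  exists setT; split => //; first exact: openT.
  by move=> t _; rewrite big_ord0 measure0 lee_fin ltW.
have e20 : 0 < e / 2 by rewrite divr_gt0.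
have [U [oU U0 UF]] := IH _ e20.
have [V [oV V0 VF]] := haar_translation_continuous mX nu_haar (mF n) e20.
exists (U `&` V); split => //; first exact: openI.
move=> t [Ut Vt]; rewrite (splitr e) EFinD big_ord_recr/=.
apply: le_trans (leeD (UF t Ut) (VF t Vt)).
have mD i : measurable (F i `\` [set y : Borel X | F i ((y : X) + t)]).
  by apply: measurableD => //; exact: borel_translate.
by apply: measureU2 => //; exact: bigsetU_measurable.
Qed.

Let haar_almost_lower_continuous (f : Borel X -> R) (r e : R) :
  measurable_fun setT f -> (forall y, -1 <= f y <= 1) -> 0 < r -> 0 < e ->
  exists U : set X, [/\ open U, U 0 & forall t, U t ->
    (nu [set y : Borel X | f ((y : X) + t)%R + r <= f y]%R <= e%:E)%E].
Proof.
move=> mf f1 r0 e0.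
(* If [f] drops by [r] between [y] and [y + t], some level set [F i] contains *)
(* [y] but not [y + t], and finitely many levels suffice since [|f| <= 1].    *)
pose F i := [set y : Borel X | i%:R * r <= f y + 1].
have mfD : measurable_fun setT (fun y => f y + 1) by exact: measurable_funD.
have mF i : measurable (F i).
  exact: measurable_le_set.
have [U [oU U0 UF]] := haar_translation_continuous_seq (Num.truncn (2 / r)).+1 mF e0.
exists U; split => // t Ut; apply: le_trans (UF t Ut).
have mft : measurable_fun setT (fun y : Borel X => f ((y : X) + t)).
  by apply: measurableT_comp mf _; exact: (borel_continuous (@add_cst_continuous X t)).
apply: le_measure.
- by apply/mem_set/measurable_le_set => //; exact: measurable_funD.
- apply/mem_set/bigsetU_measurable => i _; apply: measurableD => //; exact: borel_translate.
- move=> y /= fyt; have /andP[f1y fy1] := f1 y.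
  have fr0 : 0 <= (f y + 1) / r by apply: divr_ge0 (ltW r0); lra.
  (* The highest level that y reaches; a drop of r leaves y + t strictly below it. *)
  pose k := Num.truncn ((f y + 1) / r).
  have /andP[k1 k2] := truncn_itv fr0; rewrite -/k in k1 k2.
  have kN : (k < (Num.truncn (2 / r)).+1)%N.
    by rewrite ltnS; apply: le_truncn; rewrite ler_pM2r ?invr_gt0//; lra.
  apply: (@bigsetU_sup _ k _ (fun i => F i `\` [set y : Borel X | F i ((y : X) + t)]) kN).
  split; rewrite /F /=.
    by rewrite -ler_pdivlMr.
  apply/negP; rewrite -ltNge.
  move: k2; rewrite ltr_pdivrMr// -natr1 mulrDl mul1r; lra.
Qed.

(** Unit complex numbers u, v at angle a satisfy |u - v|^2 = 2 - 2 cos a. If cos a <= 1 - r, the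
    real or the imaginary part therefore moves by at least sqrt r, up or down; each of these four
    cases costs e/4. *)
Lemma haar_almost_continuous (b : X -> R) (r e : R) : Tmeasurable b -> 0 < r -> 0 < e ->
  exists U : set X, [/\ open U, U 0 & forall t, U t ->
    (nu [set y : Borel X | cos (2 * pi * (b ((y : X) + t) - b y)) <= 1 - r]%R <= e%:E)%E].
Proof.
move=> [mc ms] r0 e0; pose s := Num.sqrt r.
have s0 : 0 < s by rewrite sqrtr_gt0.
have sr : s ^+ 2 = r by rewrite sqr_sqrtr// ltW.
have e40 : 0 < e / 4 by rewrite divr_gt0.
have b1 (f : R -> R) : (forall x, -1 <= f x) -> (forall x, f x <= 1) ->
    forall y : Borel X, -1 <= f (2 * pi * b y) <= 1.
  by move=> f1 f2 y; rewrite f1 f2.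
have N1 (f : Borel X -> R) : (forall y, -1 <= f y <= 1) -> forall y, -1 <= - f y <= 1.
  by move=> f1 y; have := f1 y; lra.
have c1 := b1 _ (@cos_geN1 R) (@cos_le1 R).
have s1 := b1 _ (@sin_geN1 R) (@sin_le1 R).
have [W1 [oW1 z1 h1]] := haar_almost_lower_continuous mc c1 s0 e40.
have [W2 [oW2 z2 h2]] := haar_almost_lower_continuous (measurable_funN mc) (N1 _ c1) s0 e40.
have [W3 [oW3 z3 h3]] := haar_almost_lower_continuous ms s1 s0 e40.
have [W4 [oW4 z4 h4]] := haar_almost_lower_continuous (measurable_funN ms) (N1 _ s1) s0 e40.
exists ((W1 `&` W2) `&` (W3 `&` W4)); split => //; first by apply: openI; exact: openI.
move=> t [[u1 u2] [u3 u4]].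
have -> : e = e / 4 + e / 4 + (e / 4 + e / 4) by field.
rewrite !EFinD.
apply: le_trans (leeD (leeD (h1 t u1) (h2 t u2)) (leeD (h3 t u3) (h4 t u4))).
have mt : circle_measurable (fun y : Borel X => b ((y : X) + t)).
  apply: (circle_measurable_comp (f := b : Borel X -> R)) => //.
  exact: (borel_continuous (@add_cst_continuous X t)).
have ml (f : Borel X -> R) : measurable_fun setT f ->
    measurable_fun setT (fun y : Borel X => f ((y : X) + t)) ->
    measurable [set y : Borel X | f ((y : X) + t) + s <= f y].
  by move=> mf mft; apply: measurable_le_set => //; exact: measurable_funD.
have [mtc mts] := mt.
have m1 := ml _ mc mtc; have m2 := ml _ (measurable_funN mc) (measurable_funN mtc).
have m3 := ml _ ms mts; have m4 := ml _ (measurable_funN ms) (measurable_funN mts).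
have m12 := measurableU _ _ m1 m2; have m34 := measurableU _ _ m3 m4.
apply: le_trans (leeD (measureU2 _ m1 m2) (measureU2 _ m3 m4)).
apply: le_trans (measureU2 _ m12 m34).
apply: le_measure; [|exact/mem_set/measurableU|].
  by apply/mem_set/measurable_cos_le/circle_measurableB.
move=> y /=; rewrite mulrBr cosB.
set ct := cos (2 * pi * b (y + t)); set st := sin (2 * pi * b (y + t)).
set c := cos _; set d := sin _ => bad.
have e1 : ct ^+ 2 + st ^+ 2 = 1 by exact: cos2Dsin2.
have e2 : c ^+ 2 + d ^+ 2 = 1 by exact: cos2Dsin2.
apply: contrapT => /not_orP[/not_orP[/negP n1 /negP n2] /not_orP[/negP n3 /negP n4]].
move: n1 n2 n3 n4; rewrite -!ltNge => n1 n2 n3 n4.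
have : (ct - c) ^+ 2 < s ^+ 2.
  by rewrite -ltr_sqrt ?exprn_gt0// !sqrtr_sqr (gtr0_norm s0) ltr_norml; apply/andP; split; lra.
have : (st - d) ^+ 2 < s ^+ 2.
  by rewrite -ltr_sqrt ?exprn_gt0// !sqrtr_sqr (gtr0_norm s0) ltr_norml; apply/andP; split; lra.
rewrite sr; nra.
Qed.

(** The shear (t, x') -> (t + x', x') pulls null sets back to null sets. For t near 0, a nonnull set
    of values, the slice of the pulled-back A contains every x' at which translation by t changes b
    little, and these have measure at least 1/2. *)
Lemma near_diagonal_nonnull (b : X -> R) (r : R) (U : set X) (A : set (Borel X * Borel X)) :
  Tmeasurable b -> 0 < r -> open U -> U 0 -> measurable A ->
  (forall x x' : X, U (x - x') -> 1 - r < cos (2 * pi * (b x - b x')) -> A (x, x')) ->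
  (nu \x nu)%E A <> 0%E.
Proof.
move=> mb r0 oU U0 mA UA A0.
have e20 : 0 < 2^-1 :> R by rewrite invr_gt0.
have [V [oV V0 Vb]] := haar_almost_continuous mb r0 e20.
have scX := compact_metrizable_second_countable cX mX.
pose sh (p : Borel X * Borel X) : Borel X * Borel X := ((p.1 : X) + p.2, p.2).
have msh : measurable_fun setT sh.
  by apply: measurable_fun_pair => //; exact: borel_add.
have mB : measurable (sh @^-1` A) by rewrite -[X in measurable X]setTI; exact: msh.
have /(null_xsection nu nu mB) B0 : ((nu \x nu) (sh @^-1` A) = 0)%E.
  apply/(null_ysection nu nu mB); move/(null_ysection nu nu mA): A0.
  apply: filterS => x' Ax'; have mAx' := measurable_ysection x' mA.
  have := nu_haar x' mAx'; rewrite Ax'; exact: etrans.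
apply: (@haar_open_nonnull (U `&` V)); [exact: openI|by []|].
apply: filterS B0 => t B0 [Ut Vt].
have := Vb t Vt; apply/negP; rewrite -ltNge.
have mt : circle_measurable (fun y : Borel X => b ((y : X) + t)).
  apply: (circle_measurable_comp (f := b : Borel X -> R)) => //.
  exact: (borel_continuous (@add_cst_continuous X t)).
have mbad := measurable_cos_le (1 - r) (circle_measurableB mt mb).
set bad := [set y | _] in mbad *.
suff -> : nu bad = 1%E by rewrite lte_fin invf_lt1// ltr1n.
apply: (ae_probability1 nu mbad).2.
have mBt := measurable_xsection t mB.
exists (xsection (sh @^-1` A) t); split => // x' /= nb; apply/xsectionP.
rewrite /sh/=; apply: UA; first by rewrite addrK.
by rewrite ltNge (addrC t); apply/negP.
Qed.

End haar_almost_continuity.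

Lemma cos_2pi_ge_int (R : realType) (a : R) :
  (forall n, 1 - n.+1%:R^-1 < cos (2 * pi * a)) -> a \is a Num.int.
Proof.
move=> ca; apply: cos_2pi_eq1; apply/eqP; rewrite eq_le cos_le1/= leNgt.
apply/negP => c1; have c0 : 0 < 1 - cos (2 * pi * a) by rewrite subr_gt0.
have [n] := @ltr_add_invr R 0 _ c0; rewrite add0r => nc.
by have := ca n; rewrite ltrBlDr -ltrBlDl ltNge (ltW nc).
Qed.

(** * Countable families of almost-everywhere statements and slices of null sets *)

Section almost_everywhere.
Context d (T : measurableType d) (R : realType) (P : probability T R).

Lemma ae_forall_count (I : countType) (Q : I -> T -> Prop) :
  (forall i, {ae P, forall x, Q i x}) -> {ae P, forall x, forall i, Q i x}.
Proof.
move=> aeQ.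
have : {ae P, forall x, forall n : nat, if choice.unpickle n is Some i then Q i x else True}.
  apply: ae_foralln => n; case: (choice.unpickle n) => [i|]; first exact: aeQ.
  exact: aeW.
by apply: filterS => x Qx i; have := Qx (choice.pickle i); rewrite choice.pickleK.
Qed.

Lemma ae_eq_measure (A B : set T) : measurable A -> measurable B ->
  {ae P, forall x, A x <-> B x} -> P A = P B.
Proof.
suff le C D : measurable C -> measurable D -> {ae P, forall x, C x <-> D x} ->
    (P C <= P D)%E.
  move=> mA mB AB; apply/eqP; rewrite eq_le le//= le//.
  by apply: filterS AB => x [? ?]; split.
move=> mC mD [N [mN N0 CDN]]; rewrite -[leRHS]adde0 -N0.
apply: le_trans (measureU2 P mD mN).
apply: le_measure; [exact: mem_set|exact/mem_set/measurableU|].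
move=> x Cx; have [Dx|nDx] := pselect (D x); [by left|right].
by apply: CDN => /= -[/(_ Cx)].
Qed.

(** The outer quantifier runs over the second coordinate, so that a base point x' can be fixed
    first. *)
Lemma null_product_ae (A : set (T * T)) : measurable A ->
  ((P \x P) A = 0)%E <-> {ae P, forall y, {ae P, forall x, ~ A (x, y)}}.
Proof.
move=> mA; rewrite (null_ysection P P mA).
have sec y : (P (ysection A y) = 0)%E <-> {ae P, forall x, ~ A (x, y)}.
  rewrite -(negligibleP P (measurable_ysection y mA)).
  rewrite /almost_everywhere/=.
  have -> // : ysection A y = ~` [set x | ~ A (x, y)].
  by apply/seteqP; split => x; rewrite /= notK => /ysectionP.
by split; apply: filterS => y /sec.
Qed.

End almost_everywhere.

(** * Functions whose increments are constant *)

Section translation_coboundary.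
Context (R : realType) (X : topologicalZmodType).
Variables (cX : compact [set: X]) (mX : metrizable R X).
Variables (nu : probability (Borel X) R) (nu_haar : haar_probability nu).
Variable b : X -> R.

Definition constant_increment (t : X) :=
  exists k : R, {ae nu, forall y : Borel X, eqT (b ((y : X) + t) - b y) k}.

Lemma constant_incrementB s t :
  constant_increment s -> constant_increment t -> constant_increment (s - t).
Proof.
move=> [k bs] [l bt]; exists (k - l).
have bs' := ae_translate nu_haar (Q := fun y => eqT (b (y + s) - b y) k) (- t) bs.
have bt' := ae_translate nu_haar (Q := fun y => eqT (b (y + t) - b y) l) (- t) bt.
apply: filterS2 bs' bt' => y; rewrite /eqT subrK => e1 e2.
rewrite (_ : y + (s - t) = y - t + s); last by rewrite addrA addrAC.
rewrite (_ : _ - _ = b (y - t + s) - b (y - t) - k - (b y - b (y - t) - l)); last by ring.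
exact: rpredB.
Qed.

(* The good translations form a subgroup of full measure. *)
Lemma constant_increment_all :
  (exists x', {ae nu, forall x : Borel X, constant_increment ((x : X) - x')}) ->
  forall t, constant_increment t.
Proof.
move=> [x' cx'] t.
have cx't := ae_translate nu_haar (Q := fun x => constant_increment (x - x')) t cx'.
have /ae_exists[x [cx cxt]] : {ae nu, forall x : Borel X,
    constant_increment ((x : X) - x') /\ constant_increment ((x : X) + t - x')}.
  by apply: filterS2 cx' cx't.
have := constant_incrementB cxt cx; congr constant_increment.
by rewrite opprB addrA subrK addrAC subrr add0r.
Qed.

(** Additivity of psi comes from reading the increments along s, t and s + t through one common
    point; continuity comes from continuity in measure of b. *)
Lemma constant_increment_character : Tmeasurable b -> (forall t, constant_increment t) ->
  exists psi : X -> R, character psi /\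
    forall t, {ae nu, forall y : Borel X, eqT (b ((y : X) + t) - b y) (psi t)}.
Proof.
move=> mb /choice[psi bpsi]; exists psi; split => //.
have psiD s t : eqT (psi (s + t)) (psi s + psi t).
  have bt := ae_translate nu_haar (Q := fun y => eqT (b (y + t) - b y) (psi t)) s (bpsi t).
  have /ae_exists[y] : {ae nu, forall y : Borel X, [/\
      eqT (b ((y : X) + (s + t)) - b y) (psi (s + t)), eqT (b ((y : X) + s) - b y) (psi s) &
      eqT (b ((y : X) + s + t) - b ((y : X) + s)) (psi t)]}.
    by apply: filterS3 (bpsi (s + t)) (bpsi s) bt.
  rewrite /eqT addrA => -[e1 e2 e3].
  rewrite (_ : _ - _ = b (y + s) - b y - psi s + (b (y + s + t) - b (y + s) - psi t)
     - (b (y + s + t) - b y - psi (s + t))); last by ring.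
  by apply: rpredB => //; exact: rpredD.
have psi_near (t : X) (e : R) : 0 < e ->
    \forall s \near t, 1 - e < cos (2 * pi * psi (s - t)).
  move=> e0; have e20 : 0 < 2^-1 :> R by rewrite invr_gt0.
  have [U [oU U0 Ub]] := haar_almost_continuous mX nu_haar mb e0 e20.
  have : nbhs t [set s | U (s - t)].
    apply: open_nbhs_nbhs; split; last by rewrite /= subrr.
    by move/continuousP: (@add_cst_continuous X (- t)); exact.
  (* The increment by s - t is a.e. the constant psi(s - t); were that far from 0, the exceptional
     set would have measure 1 instead of at most 1/2. *)
  apply: filterS => s /= Us; rewrite ltNge; apply/negP => bad.
  have := Ub _ Us; apply/negP; rewrite -ltNge.
  have mbs : circle_measurable (fun y : Borel X => b ((y : X) + (s - t)) - b y).
    apply: circle_measurableB => //; apply: (circle_measurable_comp (f := b : Borel X -> R)) => //.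
    exact: (borel_continuous (@add_cst_continuous X (s - t))).
  suff -> : nu [set y : Borel X | cos (2 * pi * (b ((y : X) + (s - t)) - b y)) <= 1 - e] = 1%E.
    by rewrite lte_fin invf_lt1// ltr1n.
  apply: (ae_probability1 nu (measurable_cos_le (1 - e) mbs)).2.
  by apply: filterS (bpsi (s - t)) => y /eqT_cos /= ->.
(* The squared chord 2 - 2 cos is then below e^2, and it bounds the square of each coordinate
   difference. *)
have dist_lt (t s : X) (e : R) : 0 < e -> 1 - e ^+ 2 / 2 < cos (2 * pi * psi (s - t)) ->
   `|cos (2 * pi * psi t) - cos (2 * pi * psi s)| < e /\
   `|sin (2 * pi * psi t) - sin (2 * pi * psi s)| < e.
  move=> e0; have -> : cos (2 * pi * psi (s - t)) = cos (2 * pi * (psi s - psi t)).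
    apply: eqT_cos; have := psiD (s - t) t; rewrite subrK /eqT => h.
    rewrite (_ : _ - _ = - (psi s - (psi (s - t) + psi t))); last by ring.
    by rewrite rpredN.
  rewrite mulrBr cosB.
  set c := cos (2 * pi * psi s); set c' := cos (2 * pi * psi t).
  set d := sin (2 * pi * psi s); set d' := sin (2 * pi * psi t) => close.
  have e1 : c ^+ 2 + d ^+ 2 = 1 by exact: cos2Dsin2.
  have e2 : c' ^+ 2 + d' ^+ 2 = 1 by exact: cos2Dsin2.
  have lt_e (u : R) : u ^+ 2 < e ^+ 2 -> `|u| < e.
    by rewrite -ltr_sqrt ?exprn_gt0// !sqrtr_sqr (gtr0_norm e0).
  by have := sqr_ge0 (c' - c); have := sqr_ge0 (d' - d); split; apply: lt_e; nra.
split => //; split => t; apply/cvgrPdist_lt => e e0;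
  (have e20 : 0 < e ^+ 2 / 2 by rewrite divr_gt0// exprn_gt0);
  by apply: filterS (psi_near t _ e20) => s /(dist_lt _ _ _ e0)[].
Qed.

End translation_coboundary.

(** * Consequences of weak mixing *)

Section weakly_mixing_action.
Context (R : realType) (G : countType) (L : group_law G) (X : topologicalZmodType).
Variables (cX : compact [set: X]) (mX : metrizable R X).
Variables (nu : probability (Borel X) R) (nu_haar : haar_probability nu).
Variables (sigma : G -> X -> X) (sigma_alg : algebraic_action L sigma).
Hypothesis sigma_wm : weakly_mixing L nu sigma.

Let sD g x y : sigma g (x + y) = sigma g x + sigma g y.
Proof. by case: sigma_alg. Qed.

Let scont g : continuous (sigma g).
Proof. by case: sigma_alg. Qed.

Let sM g h x : sigma (gmul L g h) x = sigma g (sigma h x).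
Proof. by case: sigma_alg. Qed.

Let sK g : cancel (sigma g) (sigma (ginv L g)).
Proof. by move=> x; rewrite -sM gmulVg; case: sigma_alg. Qed.

Let sVK g : cancel (sigma (ginv L g)) (sigma g).
Proof.
move=> x; have [_ _ sbij _ _] := sigma_alg.
by apply: (bij_inj (sbij (ginv L g))); rewrite sK.
Qed.

Let sigma_nu g (A : set (Borel X)) : measurable A -> nu (sigma g @^-1` A) = nu A.
Proof.
apply: (haar_automorphism cX mX nu_haar (sD g) (@scont g)).
by move=> y; exists (sigma (ginv L g) y); exact: sVK.
Qed.

Let ae_sigma g (Q : X -> Prop) :
  {ae nu, forall x : Borel X, Q x} -> {ae nu, forall x : Borel X, Q (sigma g x)}.
Proof.
apply: ae_comp; first exact: borel_continuous.
by move=> A mA; exact: sigma_nu.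
Qed.

(** G being countable, the preimages of all exceptional null sets under all group elements have a
    null union, and its complement is invariant at every point. *)
Let invariant_conull (Q : G -> X -> Prop) :
  (forall g, {ae nu, forall x : Borel X, Q g x}) ->
  exists X0 : set (Borel X), [/\ measurable X0, {ae nu, forall x, X0 x},
    forall h x, X0 (sigma h x) <-> X0 x & forall g x, X0 x -> Q g x].
Proof.
move=> /choice[N NQ].
pose X0 := [set x : Borel X | forall gh : G * G, ~ N gh.1 (sigma gh.2 x)].
have X0s h x : X0 x -> X0 (sigma h x).
  by move=> X0x [g k] /=; rewrite -sM; exact: (X0x (g, gmul L k h)).
exists X0; split.
- rewrite (_ : X0 = ~` \bigcup_(gh : G * G) (sigma gh.2 @^-1` N gh.1)); last first.
    rewrite setC_bigcup; apply/seteqP; split => x; first by move=> X0x gh _; exact: X0x.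
    by move=> X0x gh; exact: X0x.
  apply: measurableC; apply: countable_bigcupT_measurable => //= -[g h].
  rewrite -[X in measurable X]setTI; apply: borel_continuous => //.
  by have [] := NQ g.
- apply: ae_forall_count => -[g h] /=; apply: (@ae_sigma h (fun x => ~ N g x)).
  have [mN N0 _] := NQ g; exists (N g); split => // x /=; exact: contrapT.
- move=> h x; split; last exact: X0s.
  by move=> /(X0s (ginv L h)); rewrite sK.
- move=> g x X0x; apply: contrapT => nQ; apply: (X0x (g, gone L)) => /=.
  have [_ _ _ _ s1] := sigma_alg; rewrite s1.
  by have [_ _] := NQ g; apply.
Qed.

(** [weakly_mixing] speaks of strictly invariant sets; cutting A down to [X0]*[X0] makes it one and
    changes it by a null set only. *)
Let zero_one (X0 : set (Borel X)) (A : set (Borel X * Borel X)) :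
  measurable X0 -> {ae nu, forall x, X0 x} -> (forall h x, X0 (sigma h x) <-> X0 x) ->
  measurable A ->
  (forall h x x', X0 x -> X0 x' -> A (sigma h x, sigma h x') <-> A (x, x')) ->
  (nu \x nu)%E A <> 0%E ->
  {ae nu, forall x', {ae nu, forall x, A (x, x')}}.
Proof.
move=> mX0 aeX0 X0s mA As A0; pose B := A `&` (X0 `*` X0).
have mB : measurable B by apply: measurableI => //; exact: measurableX.
have [g||B1] := sigma_wm mB.
- apply/seteqP; split => -[x x'] [/= Axx' [X0x X0x']].
    by move: X0x X0x' => /= /X0s X0x /X0s X0x'; split => //; exact/(As g).
  by split; [exact/(As g)|split; exact/X0s].
- move=> /(null_product_ae nu mB) B0; exfalso; apply/A0/(null_product_ae nu mA).
  apply: filterS2 (aeX0) B0 => x' X0x'; apply: filterS2 (aeX0) => x X0x nB Ax.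
  exact: nB.
have mCB : measurable (~` B) by exact: measurableC.
have /(null_product_ae nu mCB) : ((nu \x nu) (~` B) = 0)%E.
  have BC : ((nu \x nu) (~` B) = 1 - (nu \x nu) B)%E by exact: probability_setC.
  by rewrite BC B1 subee.
by apply: filterS => x'; apply: filterS => x /contrapT[].
Qed.

(** Here exp(2 pi i b) is an eigenfunction. The difference b(x) - b(x') is invariant and is close to
    0 on a nonnull set of pairs, at every scale; so b is a.e. constant and its eigenvalues are
    trivial. *)
Lemma weakly_mixing_eigenvalue_trivial (lambda : G -> R) (b : X -> R) :
  Tmeasurable b ->
  (forall g, {ae nu, forall x : Borel X, eqT (b (sigma (ginv L g) x) - b x) (lambda g)}) ->
  forall g, lambda g \is a Num.int.
Proof.
move=> mb eig; have [X0 [mX0 aeX0 X0s X0e]] := invariant_conull eig.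
pose A n := [set p : Borel X * Borel X | 1 - n.+1%:R^-1 < cos (2 * pi * (b p.1 - b p.2))].
have mA n : measurable (A n).
  by apply/measurable_cos_gt/circle_measurableB;
    apply: (circle_measurable_comp (f := b : Borel X -> R)).
have aeA n : {ae nu, forall x', {ae nu, forall x, A n (x, x')}}.
  apply: (zero_one mX0 aeX0 X0s (mA n)).
    move=> h x x' X0x X0x'; rewrite /A/=.
    have /(X0e h) := (X0s h x).2 X0x; have /(X0e h) := (X0s h x').2 X0x'.
    rewrite !sK /eqT => e' e; rewrite (@eqT_cos _ (b (sigma h x) - b (sigma h x')) (b x - b x'))//.
    rewrite /eqT (_ : _ - _ = b x' - b (sigma h x') - lambda h - (b x - b (sigma h x) - lambda h)); last by ring.
    exact: rpredB.
  by apply: (near_diagonal_nonnull cX mX nu_haar (r := n.+1%:R^-1) mb _ openT _ (mA n)).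
have [x' bx'] : exists x', {ae nu, forall x : Borel X, eqT (b x) (b x')}.
  have /ae_foralln/ae_exists[x' Ax'] := aeA; exists x'.
  have /ae_foralln := Ax'; apply: filterS => x Ax; exact: cos_2pi_ge_int.
move=> g; have /ae_exists[x] : {ae nu, forall x : Borel X, [/\ eqT (b x) (b x'),
    eqT (b (sigma (ginv L g) x)) (b x') & eqT (b (sigma (ginv L g) x) - b x) (lambda g)]}.
  apply: filterS3 bx' (ae_sigma (ginv L g) bx') (eig g) => x e1 e2 e3; split => //.
rewrite /eqT => -[e1 e2 e3].
rewrite (_ : lambda g = b (sigma (ginv L g) x) - b x' - (b x - b x')
   - (b (sigma (ginv L g) x) - b x - lambda g)); last by ring.
by apply: rpredB => //; exact: rpredB.
Qed.

(** The character psi is the a.e. constant increment of b; subtracting the equation at x from the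
    one at x + t recovers c(g)(t). *)
Lemma weakly_mixing_character (c : G -> X -> R) (chi : G -> R) (b : X -> R) :
  (forall g, character (c g)) -> Tmeasurable b ->
  (forall g, {ae nu, forall x : Borel X,
     eqT (c g x + b (sigma (ginv L g) x) - b x) (chi g)}) ->
  exists psi : X -> R, character psi /\
    forall g x, eqT (c g x) (psi x - psi (sigma (ginv L g) x)).
Proof.
move=> cchar mb coh; have [X0 [mX0 aeX0 X0s X0e]] := invariant_conull coh.
have scX := compact_metrizable_second_countable cX mX.
(* In [D] the characters [c g] and the constants [chi g] cancel, so [D] is  *)
(* invariant under the diagonal action, up to a.e. equality in [y].         *)
pose D (x x' y : X) := b (x + y) - b (x' + y) - (b x - b x').
pose M n := [set q : Borel X * Borel X * Borel X |
  1 - n.+1%:R^-1 < cos (2 * pi * D q.1.1 q.1.2 q.2)].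
have mM n : measurable (M n).
  have bm (p : Borel X * Borel X * Borel X -> Borel X) : measurable_fun setT p ->
      circle_measurable (fun q => b (p q)).
    by move=> mp; apply: (circle_measurable_comp (f := b : Borel X -> R)).
  have m1 : measurable_fun setT (fun q : Borel X * Borel X * Borel X => q.1.1).
    by apply: measurableT_comp => //; exact: measurable_fst.
  have m2 : measurable_fun setT (fun q : Borel X * Borel X * Borel X => q.1.2).
    by apply: measurableT_comp => //; exact: measurable_snd.
  have mD (p q : Borel X * Borel X * Borel X -> Borel X) :
      measurable_fun setT p -> measurable_fun setT q ->
      measurable_fun setT (fun z => (p z : X) + q z : Borel X).
    move=> mp mq; apply: (measurableT_comp (borel_add scX) (g := fun z => (p z, q z))).
    exact: measurable_fun_pair.
  apply: measurable_cos_gt; apply: circle_measurableB; apply: circle_measurableB;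
    apply: bm => //; exact: mD.
have mMx n p : measurable (xsection (M n) p) by exact: measurable_xsection.
(* The law of [D x x'] gives mass above 1 - 1/(n+1) to a neighbourhood of 0; for all n together this
   says that the law is the Dirac mass at 0. *)
pose E n := [set p : Borel X * Borel X |
  ((1 - n.+1%:R^-1)%:E < nu (xsection (M n) p))%E].
have mE n : measurable (E n).
  have mf := measurable_fun_xsection nu (mM n).
  by have := emeasurable_fun_o_infty measurableT mf (1 - n.+1%:R^-1)%:E; rewrite setTI.
have Es n h x x' : X0 x -> X0 x' -> E n (sigma h x, sigma h x') <-> E n (x, x').
  move=> X0x X0x'.
  suff -> : E n (sigma h x, sigma h x') = E n (x, x') by [].
  rewrite /E /=; congr (_ < _)%E.
  (* As [sigma h] preserves [nu], y may be replaced by [sigma h y]; for almost every y the cocycle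
     equation is then available at x, x', x + y and x' + y. *)
  rewrite -(sigma_nu h (mMx n (sigma h x, sigma h x'))).
  apply: ae_eq_measure => //.
    by rewrite -[X in measurable X]setTI; apply: borel_continuous.
  have ax := ae_translate nu_haar (Q := X0) x aeX0.
  have ax' := ae_translate nu_haar (Q := X0) x' aeX0.
  apply: filterS2 ax ax' => y; rewrite ![(y : X) + _]addrC => X0xy X0x'y.
  suff DE : eqT (D (sigma h x) (sigma h x') (sigma h y)) (D x x' y).
    by split => /xsectionP /= My; apply/xsectionP; move: My; rewrite /M /= (eqT_cos DE).
  have bs z : X0 z -> b (sigma h z) - (c h (sigma h z) + b z - chi h) \is a Num.int.
    move=> /(X0s h) /(X0e h); rewrite sK /eqT -rpredN; congr (_ \is a Num.int); ring.
  have [cD _] := cchar h.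
  have k1 := bs _ X0x; have k2 := bs _ X0x'; have k3 := bs _ X0xy; have k4 := bs _ X0x'y.
  have k5 := cD (sigma h x) (sigma h y); have k6 := cD (sigma h x') (sigma h y).
  rewrite sD in k3; rewrite sD in k4.
  have := rpredB (rpredD (rpredD (rpredB (rpredB k3 k4) k1) k2) k5) k6.
  by rewrite /eqT /D; move/eq_int; apply; ring.
have E0 n : (nu \x nu)%E (E n) <> 0%E.
  pose r : R := n.+1%:R^-1.
  have r0 : 0 < r by rewrite invr_gt0.
  (* With both cosines above 1 - r/4, [cosB_ge] gives more than 4(1 - r/4) - 3 = 1 - r; a bad set of
     mass at most r/2 leaves more than 1 - r. *)
  have r40 : 0 < r / 4 by rewrite divr_gt0.
  have r20 : 0 < r / 2 by rewrite divr_gt0.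
  have [U [oU U0 Ub]] := haar_almost_continuous mX nu_haar mb r40 r20.
  apply: (near_diagonal_nonnull cX mX nu_haar mb r40 oU U0 (mE n)) => x x' Uxx' bxx'.
  rewrite /E /= -/r.
  pose bad := [set y : Borel X | cos (2 * pi * (b ((y : X) + (x - x')) - b y)) <= 1 - r / 4].
  have mbad : measurable bad.
    apply/measurable_cos_le/circle_measurableB => //.
    apply: (circle_measurable_comp (f := b : Borel X -> R)) => //.
    exact: (borel_continuous (@add_cst_continuous X (x - x'))).
  have mCbad := measurableC mbad.
  have [u bu] : exists u : R, nu bad = u%:E.
    by exists (fine (nu bad)); rewrite fineK// fin_num_measure.
  have ur : u <= r / 2 by rewrite -lee_fin -bu; exact: Ub.
  have Cbu : nu (~` bad) = (1 - u)%:E by rewrite EFinB -bu; exact: probability_setC.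
  apply: (@lt_le_trans _ _ (nu (~` bad))); first by rewrite Cbu lte_fin; lra.
  rewrite -(nu_haar x' mCbad); apply: le_measure; [|exact: mem_set|].
    by apply: mem_set; exact: (borel_translate x' mCbad).
  move=> y /= /negP; rewrite -ltNge (_ : y + x' + (x - x') = x + y); last first.
    by rewrite addrCA addrK.
  move=> cy; apply/xsectionP; rewrite /M /= -/r /D.
  have := cosB_ge (2 * pi * (b (x + y) - b (x' + y))) (2 * pi * (b x - b x')).
  by rewrite -mulrBr (addrC x'); lra.
have aeE n := zero_one mX0 aeX0 X0s (mE n) (Es n) (E0 n).
have ci : forall t, constant_increment nu b t.
  apply: (constant_increment_all nu_haar).
  have /ae_foralln/ae_exists[x' Ex'] := aeE; exists x'.
  have /ae_foralln := Ex'; apply: filterS => x Ex.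
  have aeM n : {ae nu, forall y, M n ((x, x'), y)}.
    (* The sets [M n] decrease in n, so the section of [M n] has mass above 1 - 1/(k+1) for every k
       >= n; [maxn m n] is such a k, chosen fine enough to exceed u. *)
    have M1 : nu (xsection (M n) (x, x')) = 1%E.
      have := probability_le1 nu (mMx n (x, x')).
      have [u Mu] : exists u : R, nu (xsection (M n) (x, x')) = u%:E.
        by exists (fine (nu (xsection (M n) (x, x')))); rewrite fineK// fin_num_measure.
      rewrite Mu lee_fin => u1; congr EFin; apply/eqP; rewrite eq_le u1 /= leNgt.
      apply/negP => ult1; have c0 : 0 < 1 - u by rewrite subr_gt0.
      have [m] := @ltr_add_invr R 0 _ c0; rewrite add0r => mu1.
      have inv_le i j : (i <= j)%N -> j.+1%:R^-1 <= i.+1%:R^-1 :> R.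
        by move=> ij; rewrite lef_pV2 ?posrE// ler_nat.
      have h1 : ((1 - (maxn m n).+1%:R^-1)%:E < nu (xsection (M (maxn m n)) (x, x')))%E := Ex _.
      have h2 : (nu (xsection (M (maxn m n)) (x, x')) <= u%:E)%E.
        rewrite -Mu; apply: le_measure; [exact: mem_set|exact: mem_set|].
        move=> y /xsectionP My; apply/xsectionP; move: My; rewrite /M /=.
        by apply: le_lt_trans; rewrite lerB// inv_le// leq_maxr.
      have := lt_le_trans h1 h2; rewrite lte_fin ltrBlDr -ltrBlDl ltNge => /negP; apply.
      by apply/ltW/(le_lt_trans _ mu1); rewrite inv_le// leq_maxl.
    have := (ae_probability1 nu (mMx n (x, x'))).1 M1.
    by apply: filterS => y /xsectionP.
  have Dy : {ae nu, forall y : Borel X, eqT (D x x' y) 0}.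
    have /ae_foralln := aeM; apply: filterS => y My.
    by rewrite /eqT subr0; exact: cos_2pi_ge_int.
  (* Replacing y by y - x' turns the vanishing of D into a constant increment of b along x - x'. *)
  have Dyx := ae_translate nu_haar (Q := fun y => eqT (D x x' y) 0) (- x') Dy.
  exists (b x - b x'); apply: filterS Dyx => y.
  rewrite /D /eqT subr0 (addrC x') subrK; congr (_ - _ - _ \is a Num.int).
  by congr b; rewrite addrC addrA addrAC.
have [psi [cpsi bpsi]] := constant_increment_character mX nu_haar mb ci.
exists psi; split => // g t.
(* One point x is chosen where the equation holds at x and at x + t, and where b has its expected
   increments, by t at x and by g^-1 t at g^-1 x. *)
have Qt := ae_translate nu_haar t (coh g).
have bs := ae_sigma (ginv L g) (bpsi (sigma (ginv L g) t)).
have [x] := ae_exists (filterI (filterI (coh g) Qt) (filterI (bpsi t) bs)).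
move=> [[/= k1 k2] [/= k3 k4]]; have [cD _] := cchar g; have k0 := cD x t.
rewrite sD in k2.
have := rpredB (rpredD (rpredB (rpredB k2 k1) k4) k3) k0.
by rewrite /eqT; move/eq_int; apply; ring.
Qed.

End weakly_mixing_action.

(** * Operations on characters and assembly of the theorem *)

Section characters.
Context (R : realType) (X : topologicalZmodType).
Implicit Types chi : X -> R.

Lemma characterN chi : character chi -> character (fun x => - chi x).
Proof.
move=> [chiD [cc sc]]; split.
  move=> x y; have := chiD x y; rewrite /eqT -rpredN; move/eq_int; apply; ring.
split.
  by under eq_fun do rewrite mulrN cosN.
by under eq_fun do rewrite mulrN sinN; move=> x; apply: continuousN; exact: sc.
Qed.

Lemma characterD chi1 chi2 :
  character chi1 -> character chi2 -> character (fun x => chi1 x + chi2 x).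
Proof.
move=> [D1 [c1 s1]] [D2 [c2 s2]]; split.
  move=> x y; have := rpredD (D1 x y) (D2 x y); rewrite /eqT; move/eq_int; apply; ring.
split.
  under eq_fun do rewrite mulrDr cosD.
  by move=> x; apply: cvgB; apply: cvgM;
    [exact: c1|exact: c2|exact: s1|exact: s2].
under eq_fun do rewrite mulrDr sinD.
by move=> x; apply: cvgD; apply: cvgM;
  [exact: s1|exact: c2|exact: c1|exact: s2].
Qed.

Lemma character_measurable chi : character chi -> Tmeasurable chi.
Proof. by move=> [_ [cc sc]]; split; exact: borel_continuous_real. Qed.

End characters.

Unset Implicit Arguments.
Set Strict Implicit.

Theorem theorem1p1 (R : realType) (G : countType) (L : group_law G)
  (G_infinite : infinite_set [set: G])
  (X : topologicalZmodType)
  (X_compact : compact [set: X]) (X_hausdorff : hausdorff_space X)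
  (X_metrizable : metrizable R X)
  (nu : probability (Borel X) R) (nu_haar : haar_probability nu)
  (sigma : G -> X -> X) (sigma_alg : algebraic_action L sigma)
  (sigma_wm : weakly_mixing L nu sigma) :
  (* Psi_1 is injective *)
  (forall chi1 chi2 : G -> R, homT L chi1 -> homT L chi2 ->
     action_cohomologous L nu sigma (Psi1 chi1) (Psi1 chi2) -> H1T_eq chi1 chi2)
  /\
  (* Phi_1 is well defined: c~(g,x) = c(g)(x) is a measurable cocycle ... *)
  (forall c : G -> X -> R, dual_cocycle L sigma c -> action_cocycle L nu sigma c)
  /\
  (* ... whose class modulo Psi_1(H^1(G,T)) depends only on [c] *)
  (forall c1 c2 : G -> X -> R, dual_cocycle L sigma c1 -> dual_cocycle L sigma c2 ->
     dual_cohomologous L sigma c1 c2 -> quot_eq L nu sigma c1 c2)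
  /\
  (* Phi_1 is a homomorphism *)
  (forall c1 c2 : G -> X -> R, dual_cocycle L sigma c1 -> dual_cocycle L sigma c2 ->
     dual_cocycle L sigma (fun g x => c1 g x + c2 g x) /\
     quot_eq L nu sigma (fun g x => c1 g x + c2 g x) (fun g x => c1 g x + c2 g x))
  /\
  (* Phi_1 is injective *)
  (forall c1 c2 : G -> X -> R, dual_cocycle L sigma c1 -> dual_cocycle L sigma c2 ->
     quot_eq L nu sigma c1 c2 -> dual_cohomologous L sigma c1 c2).
Proof.
have homT0 : homT L (fun=> 0 : R) by move=> g h; rewrite /eqT addr0 subrr rpred0.
split; [|split; [|split; [|split]]].
- move=> chi1 chi2 _ _ [b [mb coh]] g; rewrite /eqT -rpredN opprB.
  apply: (weakly_mixing_eigenvalue_trivial X_compact X_metrizable nu_haar sigma_alg sigma_wm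
    (lambda := fun g => chi2 g - chi1 g) mb) => h.
  by apply: filterS (coh h) => x; rewrite /eqT /Psi1; move/eq_int; apply; ring.
- move=> c [cchar ccoc]; split=> [g|g h]; first exact: character_measurable.
  apply: aeW => x; have := ccoc g h x; rewrite /eqT -rpredN; move/eq_int; apply; ring.
- move=> c1 c2 _ _ [xi [cxi coh]]; exists (fun=> 0); split => //.
  exists (fun x => - xi x); split; first exact/character_measurable/characterN.
  move=> g; apply: aeW => x; have := coh g x; rewrite /eqT /Psi1; move/eq_int; apply; ring.
- move=> c1 c2 [c1char c1coc] [c2char c2coc]; split.
    split=> [g|g h x]; first exact: characterD.
    have := rpredD (c1coc g h x) (c2coc g h x); rewrite /eqT; move/eq_int; apply; ring.
  exists (fun=> 0); split => //; exists (fun=> 0); split.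
    by split; exact: measurable_cst.
  by move=> g; apply: aeW => x; rewrite /eqT /Psi1 subr0 !addr0 subrr rpred0.
- move=> c1 c2 [c1char _] [c2char _] [chi [_ [b [mb coh]]]].
  have [g|g|psi [cpsi psic]] := weakly_mixing_character X_compact X_metrizable nu_haar
    sigma_alg sigma_wm (c := fun g x => c1 g x - c2 g x) (chi := chi) _ mb.
  + by apply: characterD => //; exact: characterN.
  + by apply: filterS (coh g) => x; rewrite /eqT /Psi1; move/eq_int; apply; ring.
  (* The sign is reversed because a coboundary is xi(g^-1 x) - xi(x), while psi satisfies c(g)(x) =
     psi(x) - psi(g^-1 x). *)
  exists (fun x => - psi x); split; first exact: characterN.
  by move=> g x; have := psic g x; rewrite /eqT; move/eq_int; apply; ring.
Qed.
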